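(* Let $M$ be a lattice log concave (LC) random variable with support $\mathcal S\subset\mathbb Z$. 1. For $x,d\in\mathbb Z$ define $$\pi_x^{(d)}=\begin{cases}\dfrac{P(M\ge x+1)P(M=d)}{P(M\ge d+1)P(M=x)}, & \text{if } x,d+1\in\mathcal S \text{ and } x\ge d,\\ 0,&\text{otherwise.}\end{cases}$$ Then: (a) $0\le\pi_x^{(d)}\le1$ for all $x,d$. (b) If $d+1\in\mathcal S$ and $N,Z$ are random variables such that $\mathcal L(N)=\mathcal L(M\mid M\ge d)$ and $\mathcal L(Z\mid N)=\mathrm{Bern}(\pi_N^{(d)})$, then $\mathcal L(N+Z)=\mathcal L(M\mid M\ge d+1)$. 2. For $x,d\in\mathbb Z$ define $$\rho_x^{(d)}=\begin{cases}\dfrac{P(M\le x-1)P(M=d)}{P(M\le d-1)P(M=x)}, & \text{if } x,d-1\in\mathcal S \text{ and } x\le d,\\ 0,&\text{otherwise.}\end{cases}$$ Then: (a) $0\le\rho_x^{(d)}\le1$ for all $x,d$. (b) If $d-1\in\mathcal S$ and $N,Z$ are random variables such that $\mathcal L(N)=\mathcal L(M\mid M\le d)$ and $\mathcal L(Z\mid N)=\mathrm{Bern}(\rho_N^{(d)})$, then $\mathcal L(N-Z)=\mathcal L(M\mid M\le d-1)$. 3. Fix $d\in\mathbb Z$ such that $P(M=d)<1$. Let $Z_+,Z_-$ be conditionally independent given $M$ with $\mathcal L(Z_+\mid M)=\mathrm{Bern}(\pi_M^{(d)})$ and $\mathcal L(Z_-\mid M)=\mathrm{Bern}(\rho_M^{(d)})$.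 Let $Z$ be independent of $Z_+,Z_-$ and $M$ with $\mathcal L(Z)=\mathrm{Bern}(q)$, where $q=P(M\ge d+1)/P(M\ne d)$. Then $$\mathcal L(M+X)=\mathcal L(M\mid M\ne d),\qquad\text{where } X=ZZ_+-(1-Z)Z_-.$$
   Context: $\mathcal L(\cdot)$ denotes law, $\mathcal L(\cdot\mid A)$ the conditional law given an event $A$; $\mathrm{Bern}(p)$ is the Bernoulli distribution with mass $p$ at $1$ and $1-p$ at $0$. The support of a discrete random variable $M$ is $\{x: P(M=x)>0\}$. An integer valued random variable $M$ with mass function $p_x=P(M=x)$ is called lattice log concave (LC) if its support is an integer interval, i.e. equals $(k_1,k_2)\cap\mathbb Z$ for some $k_1,k_2\in\mathbb Z\cup\{\pm\infty\}$ with $k_1<k_2-1$, and $p_x^2\ge p_{x-1}p_{x+1}$ for all $x\in\mathbb Z$. *)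

(* Defs.v *)
From HB Require Import structures.
From mathcomp Require Import all_boot all_order all_algebra.
From mathcomp Require Import all_classical all_reals all_analysis.
Set Implicit Arguments.
Unset Strict Implicit.
Unset Printing Implicit Defensive.
Import Order.TTheory GRing.Theory Num.Theory.
Import numFieldNormedType.Exports.
Local Open Scope classical_set_scope.
Local Open Scope ring_scope.

(* The library equips unit, bool and nat, but not int, with the discrete
   sigma-algebra. *)
HB.instance Definition _ := isPointed.Build int 0.

HB.instance Definition _ := @isMeasurable.Build default_measure_display
  int discrete_measurable discrete_measurable0
  discrete_measurableC discrete_measurableU.

Section defs.
Context {d : measure_display} {T : measurableType d} {R : realType}.
Variable P : probability T R.

Definition prob (A : set T) : R := fine (P A).

(* P(E | A), with the junk value 0 when P(A) = 0. *)
Definition cond_prob (A E : set T) : R := prob (E `&` A) / prob A.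

Definition cond_law (A : set T) (X : T -> int) : set int -> \bar R :=
  fun B => (cond_prob A (X @^-1` B))%:E.

(* The library's Bernoulli measure lives on bool; this is its image on int. *)
Definition bernoulli_int (p : R) : set int -> \bar R :=
  pushforward (bernoulli_prob p) (fun b : bool => (nat_of_bool b)%:Z).

(* L(Z | N) = Bern(f N), for N with values in the countable type int. *)
Definition cond_bernoulli (N Z : T -> int) (f : int -> R) : Prop :=
  forall n : int, (0 < P [set t | N t = n])%E ->
    cond_law [set t | N t = n] Z = bernoulli_int (f n).

Definition independent_RV {d1 d2 : measure_display} {T1 : measurableType d1}
    {T2 : measurableType d2} (X : T -> T1) (Y : T -> T2) : Prop :=
  forall (A : set T1) (B : set T2), measurable A -> measurable B ->
    P (X @^-1` A `&` Y @^-1` B) = (P (X @^-1` A) * P (Y @^-1` B))%E.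

Definition cond_independent_RV (M X Y : T -> int) : Prop :=
  forall m : int, (0 < P [set t | M t = m])%E ->
  forall A B : set int,
    cond_prob [set t | M t = m] (X @^-1` A `&` Y @^-1` B) =
    cond_prob [set t | M t = m] (X @^-1` A) *
    cond_prob [set t | M t = m] (Y @^-1` B).

Variable M : T -> int.

Definition support_RV : set int := [set x | (0 < P [set t | M t = x])%E].

(* The open integer interval (k1, k2) has its endpoints in \bar int. *)
Definition lattice_log_concave : Prop :=
  (exists k1 k2 : \bar int, (k1 < k2 - 1%:E)%E /\
     support_RV = [set x : int | (k1 < x%:E)%E /\ (x%:E < k2)%E]) /\
  (forall x : int,
     prob [set t | M t = x - 1] * prob [set t | M t = x + 1] <=
     prob [set t | M t = x] ^+ 2).

Definition pi_coef (d0 x : int) : R :=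
  if `[< support_RV x /\ support_RV (d0 + 1) /\ d0 <= x >] then
    (prob [set t | x + 1 <= M t] * prob [set t | M t = d0]) /
    (prob [set t | d0 + 1 <= M t] * prob [set t | M t = x])
  else 0.

Definition rho_coef (d0 x : int) : R :=
  if `[< support_RV x /\ support_RV (d0 - 1) /\ x <= d0 >] then
    (prob [set t | M t <= x - 1] * prob [set t | M t = d0]) /
    (prob [set t | M t <= d0 - 1] * prob [set t | M t = x])
  else 0.

End defs.

(* Main.v *)
(* With p x = P(M = x) and tail x = P(M >= x), the flow of mass out of x >= d
   under the Bernoulli shift is p x * pi_x = tail (x + 1) * p d / tail (d + 1).
   It telescopes: for x > d the atom p x gains
   (tail x - tail (x + 1)) * p d / tail (d + 1) = p x * p d / tail (d + 1),
   which multiplies it by tail d / tail (d + 1), while the atom at d is emptied.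
   The bound pi_x <= 1 is p d * tail (x + 1) <= p x * tail (d + 1), the sum over
   j >= 1 of p d * p (x + j) <= p x * p (d + j), a consequence of log concavity.
   The downward shift is the upward shift of - M, and in part 3 conditioning on
   Z mixes the two shifted laws with weights U / (U + L) and L / (U + L), where
   U = P(M > d) and L = P(M < d); here U + L + p d = 1. *)
Require Import Defs.
From HB Require Import structures.
From mathcomp Require Import all_boot all_order all_algebra.
From mathcomp Require Import all_classical all_reals all_analysis.
From mathcomp Require Import zify ring lra.
Import Order.TTheory GRing.Theory Num.Theory.
Import numFieldNormedType.Exports.
Local Open Scope classical_set_scope.
Local Open Scope ring_scope.

(** * Events and functions of integer valued maps *)

Section Prob.
Context {d : measure_display} {T : measurableType d} {R : realType}.
Variable P : probability T R.
Implicit Types A B : set T.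

Lemma prob_fineK {A} : measurable A -> (prob P A)%:E = P A.
Proof. by move=> mA; rewrite /prob fineK// fin_num_measure. Qed.

Lemma prob_ge0 A : 0 <= prob P A.
Proof. exact: fine_ge0. Qed.

Lemma prob_set0 : prob P set0 = 0.
Proof. by rewrite /prob measure0. Qed.

Lemma prob_setT : prob P setT = 1.
Proof. by rewrite /prob probability_setT. Qed.

Lemma prob_le {A B} : measurable A -> measurable B -> A `<=` B ->
  prob P A <= prob P B.
Proof.
by move=> mA mB AB; rewrite -lee_fin !prob_fineK// le_measure ?inE.
Qed.

Lemma prob_setU A B : measurable A -> measurable B -> A `&` B = set0 ->
  prob P (A `|` B) = prob P A + prob P B.
Proof.
move=> mA mB AB; apply: EFin_inj.
by rewrite EFinD !prob_fineK ?measureU//; exact: measurableU.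
Qed.

Lemma prob_gt0 A : measurable A -> (0 < P A)%E = (0 < prob P A).
Proof. by move=> mA; rewrite -prob_fineK// lte_fin. Qed.

Lemma measurable_preimage_int {X : T -> int} (B : set int) :
  measurable_fun setT X -> measurable (X @^-1` B).
Proof. by move=> mX; rewrite -[_ @^-1` _]setTI; exact: mX. Qed.

(** Every set of integers is measurable, so [h] can be arbitrary: the preimage is cut along the
    countably many values of [X]. *)
Lemma measurable_comp_int2 {X Y : T -> int} (h : int -> int -> int) :
  measurable_fun setT X -> measurable_fun setT Y ->
  measurable_fun setT (fun t => h (X t) (Y t)).
Proof.
move=> mX mY _ B _; rewrite setTI.
have -> : (fun t => h (X t) (Y t)) @^-1` B =
    \bigcup_n (X @^-1` [set n] `&` Y @^-1` (h n @^-1` B)).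
  by apply/seteqP; split => t /= => [Bt|[n _ [/= -> //]]]; exists (X t).
apply: countable_bigcupT_measurable => // n.
by apply: measurableI; exact: measurable_preimage_int.
Qed.

(** Cutting along the code of [X] under [pickle] turns countable additivity over the integers into a
    series over the naturals. *)
Lemma prob_preimage_series (X : T -> int) A (B : set int) :
  measurable_fun setT X -> measurable A ->
  P (A `&` X @^-1` B) =
  (\sum_(i <oo) P (A `&` X @^-1` (B `&` [set n | pickle n = i])))%E.
Proof.
move=> mX mA.
pose F i := A `&` X @^-1` (B `&` [set n | pickle n = i]).
have mF i : measurable (F i).
  by apply: measurableI => //; exact: measurable_preimage_int.
rewrite -(@measure_semi_bigcup _ _ _ P F) //.
- congr (P _); apply/seteqP; split => t /=.
    by case=> At Bt; exists (pickle (X t)).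
  by case=> i _ [At [Bt _]].
- by move=> i j _ _ [t [[_ [_ /= <-]] [_ [_ /= <-]]]].
- exact: bigcupT_measurable.
Qed.

End Prob.

(* A countable-additivity principle: atomwise comparison suffices.  With c, c'
   as normalising constants it compares laws and tails alike. *)
Lemma prob_preimage_le {d d'} {T : measurableType d} {T' : measurableType d'}
    {R : realType} (P : probability T R) (Q : probability T' R)
    (X : T -> int) (Y : T' -> int) (A : set T) (A' : set T') (B : set int)
    (c c' : R) :
  measurable_fun setT X -> measurable_fun setT Y ->
  measurable A -> measurable A' -> 0 <= c -> 0 <= c' ->
  (forall n, B n -> c * prob P (A `&` [set t | X t = n]) <=
                    c' * prob Q (A' `&` [set t | Y t = n])) ->
  c * prob P (A `&` X @^-1` B) <= c' * prob Q (A' `&` Y @^-1` B).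
Proof.
move=> mX mY mA mA' c0 c'0 le_atoms.
have mXB C : measurable (A `&` X @^-1` C).
  by apply: measurableI => //; exact: measurable_preimage_int.
have mYB C : measurable (A' `&` Y @^-1` C).
  by apply: measurableI => //; exact: measurable_preimage_int.
rewrite -lee_fin !EFinM !prob_fineK// !prob_preimage_series//.
rewrite -!nneseriesZl//.
apply: lee_nneseries => [i _ _|i _]; first by rewrite mule_ge0// lee_fin.
(* Since [pickle] is injective, the slice of index [i] is a single point of [B] or empty. *)
have [[n [Bn <-]]|noB] := pselect (exists n, B n /\ pickle n = i).
  have -> : B `&` [set m | pickle m = pickle n] = [set n].
    apply/seteqP; split => m /= => [[_ /(pcan_inj (@pickleK int))//]|->//].
  rewrite -!prob_fineK// -!EFinM lee_fin; exact: le_atoms.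
have -> : B `&` [set n | pickle n = i] = set0.
  by apply/seteqP; split => n //= [Bn ni]; case: noB; exists n.
by rewrite !preimage_set0 !setI0 !measure0 !mule0.
Qed.

(** * Laws determined by their atoms, and Bernoulli shifts *)

Section ProbInt.
Context {d : measure_display} {T : measurableType d} {R : realType}.
Variable P : probability T R.

Lemma prob_preimage_eq0 (X : T -> int) (A : set T) (B : set int) :
  measurable_fun setT X -> measurable A ->
  (forall n, B n -> prob P (A `&` [set t | X t = n]) = 0) ->
  prob P (A `&` X @^-1` B) = 0.
Proof.
move=> mX mA atoms0; apply/eqP; rewrite eq_le prob_ge0 andbT.
have := @prob_preimage_le _ _ _ _ _ P P X X A A B 1 0 mX mX mA mA ler01 (lexx 0).
rewrite mul1r mul0r; apply => n /atoms0 ->.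
by rewrite mulr0 mul0r.
Qed.

(** Atoms determine a law: the atomwise comparison is applied in both directions. Equalities of laws
    thus reduce to identities between point masses. *)
Lemma pushforward_eq_cond_law {d'} {T' : measurableType d'}
    (Q : probability T' R) (X : T -> int) (Y : T' -> int) (S : set int) :
  measurable_fun setT X -> measurable_fun setT Y ->
  (forall n, prob Q [set t | Y t = n] =
             cond_prob P (X @^-1` S) [set t | X t = n]) ->
  pushforward Q Y = cond_law P (X @^-1` S) X.
Proof.
move=> mX mY eq_atoms; apply/funext => B.
have mXS := measurable_preimage_int S mX.
rewrite /pushforward /cond_law -prob_fineK; last exact: measurable_preimage_int.
congr (_%:E); rewrite /cond_prob.
have inv0 : 0 <= (prob P (X @^-1` S))^-1 by rewrite invr_ge0 prob_ge0.
have atoms n : 1 * prob Q (setT `&` [set t | Y t = n]) =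
    (prob P (X @^-1` S))^-1 * prob P (X @^-1` S `&` [set t | X t = n]).
  by rewrite setTI mul1r eq_atoms /cond_prob setIC mulrC.
rewrite setIC [RHS]mulrC -[LHS]mul1r -[_ @^-1` B in LHS]setTI.
by apply/eqP; rewrite eq_le; apply/andP; split;
  apply: prob_preimage_le => // n _; rewrite atoms.
Qed.

(** A Bernoulli variable is 0 or 1 only almost surely, so other values are discarded as a null event
    rather than excluded pointwise. *)
Lemma prob_split_bool (A : set T) (X : T -> int) :
  measurable_fun setT X -> measurable A ->
  prob P (X @^-1` (~` [set 0; 1])) = 0 ->
  prob P A = prob P (A `&` [set t | X t = 0]) + prob P (A `&` [set t | X t = 1]).
Proof.
move=> mX mA null.
have mXB (C : set int) := measurable_preimage_int C mX.
have mAX (C : set int) : measurable (A `&` X @^-1` C) by apply: measurableI.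
rewrite -prob_setU; [|exact: (mAX [set 0])|exact: (mAX [set 1])|]; last first.
  by apply/seteqP; split => t //= [[_ ->] []].
have -> : prob P A = prob P (A `&` X @^-1` [set 0; 1]) +
    prob P (A `&` X @^-1` (~` [set 0; 1])).
  rewrite -prob_setU//; first by rewrite -setIUr -preimage_setU setUv setIT.
  by rewrite setIACA -preimage_setI setICr preimage_set0 setI0.
have -> : prob P (A `&` X @^-1` (~` [set 0; 1])) = 0.
  apply/eqP; rewrite eq_le prob_ge0 andbT -null.
  by apply: prob_le => // t [].
by rewrite addr0 -setIUr.
Qed.

Lemma bernoulli_intE (p : R) (B : set int) : 0 <= p <= 1 ->
  bernoulli_int p B = (p * \1_B 1 + (1 - p) * \1_B 0)%:E.
Proof.
by move=> p01; rewrite /bernoulli_int /pushforward bernoulli_probE// !diracE.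
Qed.

(** Clearing the denominator makes the formula valid at null atoms too, where [cond_bernoulli] says
    nothing but both sides are 0. *)
Lemma cond_bernoulli_prob (N Z : T -> int) (f : int -> R) (n : int)
    (B : set int) :
  measurable_fun setT N -> measurable_fun setT Z -> 0 <= f n <= 1 ->
  cond_bernoulli P N Z f ->
  prob P ([set t | N t = n] `&` Z @^-1` B) =
  prob P [set t | N t = n] * (f n * \1_B 1 + (1 - f n) * \1_B 0).
Proof.
move=> mN mZ f01 NZ.
have mNn : measurable [set t | N t = n] := measurable_preimage_int [set n] mN.
have mZB := measurable_preimage_int B mZ.
have mNZ : measurable ([set t | N t = n] `&` Z @^-1` B) by exact: measurableI.
have [N0|Npos] := eqVneq (prob P [set t | N t = n]) 0.
  rewrite N0 mul0r; apply/eqP; rewrite eq_le prob_ge0 andbT -N0.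
  by apply: prob_le => // t [].
have /NZ/(congr1 (@^~ B)) : (0 < P [set t | N t = n])%E.
  by rewrite prob_gt0// lt_def Npos prob_ge0.
rewrite /cond_law /cond_prob bernoulli_intE// => -[<-].
by rewrite mulrCA divff// mulr1 setIC.
Qed.

Lemma cond_bernoulli_notin (N Z : T -> int) (f : int -> R) :
  measurable_fun setT N -> measurable_fun setT Z ->
  (forall n, 0 <= f n <= 1) -> cond_bernoulli P N Z f ->
  prob P (Z @^-1` (~` [set 0; 1])) = 0.
Proof.
move=> mN mZ f01 NZ.
rewrite -[_ @^-1` _]setIT -(preimage_setT N).
apply: prob_preimage_eq0 => // [|n _]; first exact: measurable_preimage_int.
rewrite setIC (@cond_bernoulli_prob _ _ f)// !indicE.
by rewrite !memNset/= ?mulr0 ?addr0 ?mulr0//; apply: contrapT; tauto.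
Qed.

Lemma prob_add_bernoulli (N Z : T -> int) (f : int -> R) (x : int) :
  measurable_fun setT N -> measurable_fun setT Z ->
  (forall n, 0 <= f n <= 1) -> cond_bernoulli P N Z f ->
  prob P [set t | N t + Z t = x] =
  prob P [set t | N t = x] * (1 - f x) +
  prob P [set t | N t = x - 1] * f (x - 1).
Proof.
move=> mN mZ f01 NZ.
rewrite (@prob_split_bool _ Z)//; first last.
- exact: cond_bernoulli_notin NZ.
- have mNZ := measurable_comp_int2 (fun a b => a + b) mN mZ.
  exact: (measurable_preimage_int [set x] mNZ).
have -> : [set t | N t + Z t = x] `&` [set t | Z t = 0] =
    [set t | N t = x] `&` Z @^-1` [set 0].
  by apply/seteqP; split => t /= [] + Zt; rewrite Zt addr0.
have -> : [set t | N t + Z t = x] `&` [set t | Z t = 1] =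
    [set t | N t = x - 1] `&` Z @^-1` [set 1].
  by apply/seteqP; split => t /= [] + Zt; rewrite Zt => Nt; split => //; lia.
rewrite !(@cond_bernoulli_prob _ _ f)// !indicE !in_set1/=.
by rewrite !mulr0 !mulr1 !add0r !addr0.
Qed.

End ProbInt.

(** Convexity of the support is stated without endpoints, a form that survives reflection. The
    second clause alone would not do: masses at 0 and 3 only satisfy it, yet
    [p 0 * p 3 <= p 1 * p 2] fails. *)
Definition gapless_log_concave {R : realType} (p : int -> R) : Prop :=
  (forall x y z, x <= y -> y <= z -> 0 < p x -> 0 < p z -> 0 < p y) /\
  (forall x, p (x - 1) * p (x + 1) <= p x ^+ 2).

(** * Cross inequalities for log concave sequences *)

Section LogConcaveSequence.
Context {R : realType} {p : int -> R}.
Hypotheses (p_ge0 : forall x, 0 <= p x) (p_lc : gapless_log_concave p).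

(** The ratios [p (y + 1) / p y] do not increase with [y]. If a factor on the left vanishes the
    claim is trivial; otherwise all points between are charged, and the inductive step, multiplied
    by [p (x + j)], passes through [p x * p (x + j + 1) ^ 2]. *)
Lemma log_concave_adjacent (x : int) (j : nat) :
  p x * p (x + j%:Z + 1) <= p (x + 1) * p (x + j%:Z).
Proof.
have [gapless sq] := p_lc.
elim: j => [|j IHj]; first by rewrite addr0 mulrC.
have [px0|px_neq0] := eqVneq (p x) 0; first by rewrite px0 mul0r mulr_ge0.
have [pz0|pz_neq0] := eqVneq (p (x + j.+1%:Z + 1)) 0.
  by rewrite pz0 mulr0 mulr_ge0.
have px_gt0 : 0 < p x by rewrite lt_def px_neq0 p_ge0.
have pz_gt0 : 0 < p (x + j.+1%:Z + 1) by rewrite lt_def pz_neq0 p_ge0.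
have py_gt0 : 0 < p (x + j%:Z) by apply: gapless px_gt0 pz_gt0; lia.
have pw_gt0 : 0 < p (x + j.+1%:Z) by apply: gapless px_gt0 pz_gt0; lia.
have := sq (x + j.+1%:Z).
have -> : x + j.+1%:Z - 1 = x + j%:Z by lia.
have jE : x + j%:Z + 1 = x + j.+1%:Z by lia.
rewrite jE in IHj => sqj.
rewrite -(ler_pM2r py_gt0).
apply: (@le_trans _ _ (p x * p (x + j.+1%:Z) ^+ 2)).
  by rewrite -mulrA ler_wpM2l// mulrC.
by rewrite expr2 mulrA [leRHS]mulrAC ler_wpM2r// ltW.
Qed.

(** Induction on the common displacement [j]: the hypothesis is multiplied by the comparison of
    consecutive ratios at [a + j] and [b + j], and the positive common factors cancel. *)
Lemma log_concave_cross (a b : int) (j : nat) : a <= b ->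
  p a * p (b + j%:Z) <= p b * p (a + j%:Z).
Proof.
have [gapless _] := p_lc.
move=> ab; elim: j => [|j IHj]; first by rewrite !addr0 mulrC.
have [pa0|pa_neq0] := eqVneq (p a) 0; first by rewrite pa0 mul0r mulr_ge0.
have [pz0|pz_neq0] := eqVneq (p (b + j.+1%:Z)) 0.
  by rewrite pz0 mulr0 mulr_ge0.
have pa_gt0 : 0 < p a by rewrite lt_def pa_neq0 p_ge0.
have pz_gt0 : 0 < p (b + j.+1%:Z) by rewrite lt_def pz_neq0 p_ge0.
have pu_gt0 : 0 < p (a + j%:Z) by apply: gapless pa_gt0 pz_gt0; lia.
have pv_gt0 : 0 < p (b + j%:Z) by apply: gapless pa_gt0 pz_gt0; lia.
have := log_concave_adjacent (a + j%:Z) `|b - a|%N.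
have -> : a + j%:Z + `|b - a|%N%:Z = b + j%:Z by lia.
have -> : b + j%:Z + 1 = b + j.+1%:Z by lia.
have -> : a + j%:Z + 1 = a + j.+1%:Z by lia.
move=> adj; rewrite -(ler_pM2r (mulr_gt0 pu_gt0 pv_gt0)).
have -> : p a * p (b + j.+1%:Z) * (p (a + j%:Z) * p (b + j%:Z)) =
  (p a * p (b + j%:Z)) * (p (a + j%:Z) * p (b + j.+1%:Z)) by ring.
have -> : p b * p (a + j.+1%:Z) * (p (a + j%:Z) * p (b + j%:Z)) =
  (p b * p (a + j%:Z)) * (p (a + j.+1%:Z) * p (b + j%:Z)) by ring.
by apply: ler_pM => //; rewrite mulr_ge0.
Qed.

End LogConcaveSequence.

(** * Log concavity and the coefficients under reflection *)

Section Shift.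
Context {d : measure_display} {T : measurableType d} {R : realType}.
Variable P : probability T R.

Lemma lattice_log_concave_gapless (M : T -> int) : measurable_fun setT M ->
  lattice_log_concave P M ->
  gapless_log_concave (fun x => prob P [set t | M t = x]).
Proof.
move=> mM [[k1 [k2 [_ suppE]]] sq]; split => // x y z xy yz.
have supp u : 0 < prob P [set t | M t = u] <-> (k1 < u%:E)%E /\ (u%:E < k2)%E.
  have := congr1 (@^~ u) suppE; rewrite /support_RV/= => <-.
  by rewrite prob_gt0//; exact: (measurable_preimage_int [set u] mM).
move=> /supp[k1x _] /supp[_ zk2]; apply/supp; split.
  by apply: lt_le_trans k1x _; rewrite lee_fin.
by apply: le_lt_trans _ zk2; rewrite lee_fin.
Qed.

Lemma preimage_opp_eq (M : T -> int) (x : int) :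
  [set t | - M t = x] = [set t | M t = - x].
Proof. by apply/seteqP; split => t /= => [<-|->]; rewrite opprK. Qed.

Lemma gapless_log_concave_opp (M : T -> int) :
  gapless_log_concave (fun x => prob P [set t | M t = x]) ->
  gapless_log_concave (fun x => prob P [set t | - M t = x]).
Proof.
case=> gapless sq; split => [x y z xy yz|x]; rewrite !preimage_opp_eq.
  by move=> px pz; apply: gapless pz px; rewrite lerN2.
have <- : - x + 1 = - (x - 1) by lia.
have <- : - x - 1 = - (x + 1) by lia.
by rewrite mulrC.
Qed.

Lemma rho_coef_opp (M : T -> int) (a x : int) :
  rho_coef P M a x = pi_coef P (fun t => - M t) (- a) (- x).
Proof.
rewrite /rho_coef /pi_coef /support_RV/= !preimage_opp_eq.
have -> : - (- a + 1) = a - 1 by lia.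
rewrite !opprK lerN2.
have -> : [set t | - x + 1 <= - M t] = [set t | M t <= x - 1].
  by apply/seteqP; split => t /=; lia.
by have -> : [set t | - a + 1 <= - M t] = [set t | M t <= a - 1]
  by apply/seteqP; split => t /=; lia.
Qed.

(** * Upper tails and the upward shift of mass *)

Section MassShift.
Context {M : T -> int}.
Hypothesis mM : measurable_fun setT M.
Local Notation p x := (prob P [set t | M t = x]).
Local Notation tail x := (prob P [set t | x <= M t]).
Hypothesis M_lc : gapless_log_concave (fun x => p x).

Let mMB (B : set int) : measurable (M @^-1` B) := measurable_preimage_int B mM.

Lemma tailS x : tail x = p x + tail (x + 1).
Proof.
rewrite -prob_setU; [|exact: (mMB [set x])|exact: (mMB [set y | x + 1 <= y])|].
  by congr prob; apply/seteqP; split => t /=; [|case=> [->//|]]; lia.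
by apply/seteqP; split => t //= [->]; lia.
Qed.

Lemma atom_le_tail x : p x <= tail x.
Proof. by rewrite tailS lerDl prob_ge0. Qed.

Lemma tail_eq0 x : (forall y, x <= y -> p y = 0) -> tail x = 0.
Proof.
move=> p0; rewrite -[[set t | _]]setTI.
apply: (@prob_preimage_eq0 _ _ _ P M setT [set y | x <= y]) => // n /=.
by rewrite setTI; exact: p0.
Qed.

Lemma support_RVE x : support_RV P M x <-> 0 < p x.
Proof. by rewrite /support_RV/= prob_gt0//; exact: (mMB [set x]). Qed.

Lemma tail_cross a x : a <= x -> p a * tail (x + 1) <= p x * tail (a + 1).
Proof.
move=> ax.
have mMs c : measurable_fun setT (fun t => M t - c).
  exact: (measurable_comp_int2 (fun u _ => u - c) mM mM).
(* Recentring turns both tails into the event that the value is at least 1, so atoms are matched by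
   their displacement from [x] and from [a]. *)
have E c : tail (c + 1) = prob P (setT `&` (fun t => M t - c) @^-1` [set n | 1 <= n]).
  by rewrite setTI; congr prob; apply/seteqP; split => t /=; lia.
have E' c n : [set t | M t - c = n] = [set t | M t = c + n].
  by apply/seteqP; split => t /=; lia.
rewrite !E; apply: prob_preimage_le; rewrite ?prob_ge0// => n /= n1.
rewrite !setTI !E'; have -> : n = `|n|%N%:Z by lia.
by apply: (log_concave_cross _ M_lc) => // y; exact: prob_ge0.
Qed.

Lemma pi_coef_itv a x : 0 <= pi_coef P M a x <= 1.
Proof.
rewrite /pi_coef; case: asboolP => [|_]; last by rewrite lexx ler01.
case=> /support_RVE px [/support_RVE pa ax].
have den : 0 < tail (a + 1) * p x.
  by rewrite mulr_gt0// (lt_le_trans pa (atom_le_tail _)).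
rewrite divr_ge0 ?mulr_ge0 ?prob_ge0//= ler_pdivrMr// mul1r.
by rewrite mulrC [leRHS]mulrC tail_cross.
Qed.

Lemma pi_coef_lt a x : x < a -> pi_coef P M a x = 0.
Proof. by rewrite /pi_coef => xa; case: asboolP => // -[_ [_]]; lia. Qed.

(** The right side no longer divides by [p x], so the formula extends to [x] outside the support. *)
Lemma pi_coef_mass a x : 0 < p (a + 1) -> a <= x ->
  p x * pi_coef P M a x = tail (x + 1) * p a / tail (a + 1).
Proof.
move=> pa1 ax.
have ta : tail (a + 1) != 0.
  by rewrite gt_eqF// (lt_le_trans pa1 (atom_le_tail _)).
rewrite /pi_coef; case: asboolP => [[/support_RVE px _]|notsupp].
  by field; rewrite ta gt_eqF.
have px0 : p x = 0.
  apply/eqP; rewrite -[_ == _]negbK; apply/negP => px; apply: notsupp.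
  by split; [|split=> //]; apply/support_RVE => //; rewrite lt_def px prob_ge0.
(* With [p x = 0], mass both at [a] and beyond [x] would leave a gap at [x], so [p a] or
   [tail (x + 1)] is 0. *)
rewrite mulr0; have [pa0|pa_neq0] := eqVneq (p a) 0.
  by rewrite pa0 mulr0 mul0r.
rewrite tail_eq0 ?mul0r// => y xy; apply/eqP; rewrite -[_ == _]negbK.
apply/negP => py; have [gapless _] := M_lc.
suff : 0 < p x by rewrite px0 ltxx.
by apply: (gapless a x y) => //; first lia; rewrite lt_def prob_ge0 andbT.
Qed.

(** Unconditioned masses let the same identity serve after conditioning on [a <= M] and in the
    two-sided shift, where points below [a] keep their mass. *)
Lemma pi_coef_shift a x : 0 < p (a + 1) ->
  p x * (1 - pi_coef P M a x) + p (x - 1) * pi_coef P M a (x - 1) =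
  if x < a then p x else if x == a then 0 else p x * (tail a / tail (a + 1)).
Proof.
move=> pa1.
have ta : tail (a + 1) != 0.
  by rewrite gt_eqF// (lt_le_trans pa1 (atom_le_tail _)).
rewrite mulrBr mulr1.
case: ltgtP => [xa|ax|->].
- by rewrite !pi_coef_lt ?mulr0 ?subr0 ?addr0//; lia.
- rewrite !pi_coef_mass//; [|lia..].
  rewrite subrK [tail x]tailS [tail a]tailS.
  by field.
- rewrite (pi_coef_lt a (a - 1)); last lia.
  by rewrite pi_coef_mass//; field.
Qed.

Lemma pi_coef_atom0 a x : p a = 0 -> pi_coef P M a x = 0.
Proof. by rewrite /pi_coef => ->; rewrite mulr0 mul0r if_same. Qed.

(* Multiplying by tail (a + 1) keeps the identity true when a + 1 is outside the
   support, where pi_coef is 0. *)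
Lemma tail_pi_coef_shift a x :
  tail (a + 1) *
    (p x * (1 - pi_coef P M a x) + p (x - 1) * pi_coef P M a (x - 1)) =
  if x < a then tail (a + 1) * p x else if x == a then 0 else p x * tail a.
Proof.
(* If [a] carries no mass nothing moves, and [tail a] equals [tail (a + 1)]. *)
have [pa0|pa_neq0] := eqVneq (p a) 0.
  rewrite !pi_coef_atom0// subr0 mulr1 mulr0 addr0 [tail a]tailS pa0 add0r.
  by case: ltgtP => [||->]; rewrite ?pa0 ?mulr0// mulrC.
have [pa1_gt0|] := ltP 0 (p (a + 1)).
  rewrite pi_coef_shift//; case: ltgtP => // _; last by rewrite mulr0.
  by field; rewrite gt_eqF// (lt_le_trans pa1_gt0 (atom_le_tail _)).
(* Here [a] has mass and [a + 1] has none, so by gaplessness nothing lies above [a] and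
   [tail (a + 1)] is 0. *)
move=> pa1_le0; have p0 y : a < y -> p y = 0.
  move=> ay; apply/eqP; rewrite -[_ == _]negbK; apply/negP => py.
  move: pa1_le0; rewrite leNgt => /negP; apply; have [gapless _] := M_lc.
  by apply: (gapless a (a + 1) y); rewrite ?lt_def ?prob_ge0 ?andbT//; lia.
rewrite tail_eq0 ?mul0r => [|y ay]; last by apply: p0; lia.
by case: ltgtP => // ax; rewrite p0// mul0r.
Qed.

(** The mass of [N] is [p x / tail a] at each [x >= a], so the conclusion is [pi_coef_shift] divided
    by [tail a]. *)
Lemma law_add_pi_coef a {d'} {T' : measurableType d'} (Q : probability T' R)
    (N Z : T' -> int) :
  measurable_fun setT N -> measurable_fun setT Z -> support_RV P M (a + 1) ->
  pushforward Q N = cond_law P [set t | a <= M t] M ->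
  cond_bernoulli Q N Z (pi_coef P M a) ->
  pushforward Q (fun t => N t + Z t) = cond_law P [set t | a + 1 <= M t] M.
Proof.
move=> mN mZ /support_RVE pa1 lawN NZ.
have cond_massE b x : cond_prob P [set t | b <= M t] [set t | M t = x] =
    if b <= x then p x / tail b else 0.
  rewrite /cond_prob; case: ifPn => bx.
    congr (prob _ _ / _); apply/seteqP; split => t /= => [[]//|Mx].
    by rewrite Mx; split.
  rewrite (_ : _ `&` _ = set0) ?prob_set0 ?mul0r//.
  by apply/seteqP; split => t //= [->] bx'; rewrite bx' in bx.
have massN x : prob Q [set t | N t = x] = if a <= x then p x / tail a else 0.
  rewrite -cond_massE; have := congr1 (@^~ [set x]) lawN.
  by rewrite /pushforward /cond_law/= /prob => ->.
apply: (@pushforward_eq_cond_law _ _ _ P _ _ Q M _ [set n | a + 1 <= n]) => //.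
  exact: measurable_comp_int2.
move=> x; rewrite (@prob_add_bernoulli _ _ _ _ _ _ _ _ mN mZ _ NZ); last first.
  exact: pi_coef_itv.
have := pi_coef_shift a x pa1.
rewrite cond_massE !massN.
have ta1 : 0 < tail (a + 1) by rewrite (lt_le_trans pa1 (atom_le_tail _)).
have ta : 0 < tail a by rewrite tailS ltr_wpDl ?prob_ge0.
case: ltgtP => [xa|ax|<-] shift.
- have -> : (a <= x - 1) = false by lia.
  have -> : (a + 1 <= x) = false by lia.
  by rewrite !mul0r addr0.
- have -> : (a <= x - 1) = true by lia.
  have -> : (a + 1 <= x) = true by lia.
  rewrite mulrAC [X in _ + X]mulrAC -mulrDl shift.
  by field; rewrite !gt_eqF.
- have -> : (x <= x - 1) = false by lia.
  have -> : (x + 1 <= x) = false by lia.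
  move: shift; rewrite (pi_coef_lt _ (x - 1)); last lia.
  rewrite mulr0 addr0 => shift.
  by rewrite mul0r addr0 mulrAC shift mul0r.
Qed.

End MassShift.
End Shift.

Section Reflection.
Context {d : measure_display} {T : measurableType d} {R : realType}.
Variable P : probability T R.

Lemma cond_bernoulli_opp (N Z : T -> int) (f g : int -> R) :
  (forall n, f n = g (- n)) -> cond_bernoulli P N Z f ->
  cond_bernoulli P (fun t => - N t) Z g.
Proof.
by move=> fg NZ n; rewrite preimage_opp_eq => /NZ ->; rewrite fg opprK.
Qed.

Lemma pushforward_opp (N : T -> int) (B : set int) :
  pushforward P (fun t => - N t) B = pushforward P N (-%R @^-1` B).
Proof. by []. Qed.

End Reflection.

(** * Upward, downward and two-sided shifts *)

Theorem lemma2p1 (R : realType) (disp : measure_display)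
    (T : measurableType disp) (P : probability T R) (M : {RV P >-> int})
    (hM : lattice_log_concave P M) :
  ((forall d x : int, 0 <= pi_coef P M d x <= 1) /\
   (forall d : int, support_RV P M (d + 1) ->
      forall (disp' : measure_display) (T' : measurableType disp')
        (Q : probability T' R) (N Z : {RV Q >-> int}),
        distribution Q N = cond_law P [set t | d <= M t] M ->
        cond_bernoulli Q N Z (pi_coef P M d) ->
        pushforward Q (fun t => N t + Z t) =
          cond_law P [set t | d + 1 <= M t] M)) /\
  ((forall d x : int, 0 <= rho_coef P M d x <= 1) /\
   (forall d : int, support_RV P M (d - 1) ->
      forall (disp' : measure_display) (T' : measurableType disp')
        (Q : probability T' R) (N Z : {RV Q >-> int}),
        distribution Q N = cond_law P [set t | M t <= d] M ->
        cond_bernoulli Q N Z (rho_coef P M d) ->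
        pushforward Q (fun t => N t - Z t) =
          cond_law P [set t | M t <= d - 1] M)) /\
  (forall d : int, (P [set t | M t = d] < 1)%E ->
     forall Zp Zm Z : {RV P >-> int},
       cond_independent_RV P M Zp Zm ->
       cond_bernoulli P M Zp (pi_coef P M d) ->
       cond_bernoulli P M Zm (rho_coef P M d) ->
       independent_RV P Z (fun t => (Zp t, Zm t, M t)) ->
       distribution P Z =
         bernoulli_int (prob P [set t | d + 1 <= M t] /
                        prob P [set t | M t <> d]) ->
       pushforward P (fun t => M t + (Z t * Zp t - (1 - Z t) * Zm t)) =
         cond_law P [set t | M t <> d] M).
Proof.
have mRV disp0 (T0 : measurableType disp0) (P0 : probability T0 R)
  (X : {RV P0 >-> int}) : measurable_fun setT X by [].
have mM : measurable_fun setT M by [].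
have mopp disp0 (T0 : measurableType disp0) (X : T0 -> int) :
    measurable_fun setT X -> measurable_fun setT (fun t => - X t).
  by move=> mX; exact: (measurable_comp_int2 (fun u _ => - u) mX mX).
have mMN := mopp _ _ _ mM.
have M_lc := lattice_log_concave_gapless P M mM hM.
have MN_lc := gapless_log_concave_opp P M M_lc.
have pi01 a x : 0 <= pi_coef P M a x <= 1 by exact: pi_coef_itv.
have rho01 a x : 0 <= rho_coef P M a x <= 1.
  by rewrite rho_coef_opp; exact: (pi_coef_itv _ mMN MN_lc).
split; [split => //|split; [split => //|]].
- move=> a supp disp' T' Q N Z lawN NZ.
  exact: (law_add_pi_coef P mM M_lc a Q).
(* The upward result for [- M] at [- a] applies to [- N]; evaluating it at reflected sets turns
   [- N + Z] back into [N - Z]. *)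
- move=> a supp disp' T' Q N Z lawN NZ.
  have suppN : support_RV P (fun t => - M t) (- a + 1).
    by rewrite /support_RV/= preimage_opp_eq opprD opprK.
  have leE b : [set t | M t <= b] = [set t | - b <= - M t].
    by apply/seteqP; split => t /=; lia.
  have lawN' : pushforward Q (fun t => - N t) =
      cond_law P [set t | - a <= - M t] (fun t => - M t).
    rewrite -leE; apply/funext => B; rewrite pushforward_opp.
    exact: (congr1 (@^~ (-%R @^-1` B)) lawN).
  have NZ' : cond_bernoulli Q (fun t => - N t) Z
      (pi_coef P (fun t => - M t) (- a)).
    by apply: cond_bernoulli_opp NZ => n; rewrite rho_coef_opp.
  have := law_add_pi_coef P mMN MN_lc (- a) Q _ _ (mopp _ _ _ (mRV _ _ _ N))
    (mRV _ _ _ Z) suppN lawN' NZ'.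
  rewrite (_ : - a + 1 = - (a - 1)); last by lia.
  rewrite -leE => lawNZ; apply/funext => B.
  have := congr1 (@^~ (-%R @^-1` B)) lawNZ.
  rewrite /cond_law /pushforward.
  have -> : (fun t => - N t + Z t) @^-1` (-%R @^-1` B) =
      (fun t => N t - Z t) @^-1` B.
    by apply/seteqP; split => t /=; rewrite opprD opprK.
  have -> // : (fun t => - M t) @^-1` (-%R @^-1` B) = M @^-1` B.
  by apply/seteqP; split => t /=; rewrite opprK.
move=> a Pa_lt1 Zp Zm Z _ MZp MZm indep lawZ.
pose p x := prob P [set t | M t = x].
pose U := prob P [set t | a + 1 <= M t].
(* The mass below [a] is written as an upper tail of [- M], the form that appears in the reflected
   shift identity. *)
pose L := prob P [set t | - a + 1 <= - M t].
pose W := prob P [set t | M t <> a].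
have mMB B := measurable_preimage_int B mM.
have p_lt1 : p a < 1 by rewrite -lte_fin prob_fineK//; exact: (mMB [set a]).
clear Pa_lt1; have WE : W = U + L.
  rewrite /W /U /L -prob_setU.
  - by congr prob; apply/seteqP; split => t /=; lia.
  - exact: (mMB [set n | a + 1 <= n]).
  - exact: (mMB [set n | - a + 1 <= - n]).
  - by apply/seteqP; split => t //=; lia.
have pW : p a + W = 1.
  rewrite -(prob_setT P) -prob_setU.
  - by congr prob; apply/seteqP; split => t //= _; exact: lem.
  - exact: (mMB [set a]).
  - exact: (mMB [set n | n <> a]).
  - by apply/seteqP; split => t //= -[].
have W_gt0 : 0 < W by lra.
have U_ge0 : 0 <= U := prob_ge0 P _.
have L_ge0 : 0 <= L := prob_ge0 P _.
have q01 : 0 <= U / W <= 1.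
  by rewrite divr_ge0 ?(ltW W_gt0)//= ler_pdivrMr// mul1r WE lerDl.
have probZ B : prob P (Z @^-1` B) = U / W * \1_B 1 + (1 - U / W) * \1_B 0.
  have := congr1 (@^~ B) lawZ; rewrite bernoulli_intE//.
  by rewrite /distribution /pushforward /prob => ->.
have ZpZmM : measurable_fun setT (fun t => (Zp t, Zm t, M t)).
  by do 2! [apply/measurable_fun_pairP; split => //].
(* Both [M + Zp] and [M - Zm] are functions of the triple, hence independent of [Z]; [g] stands for
   either. *)
have indepZ b (g : int * int * int -> int) x :
    measurable_fun setT g ->
    prob P ([set t | g (Zp t, Zm t, M t) = x] `&` [set t | Z t = b]) =
    prob P [set t | Z t = b] * prob P [set t | g (Zp t, Zm t, M t) = x].
  move=> mg; rewrite setIC /prob.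
  have := indep [set b] (g @^-1` [set x]) I (measurable_preimage_int [set x] mg).
  rewrite /preimage/= => ->.
  have mgZ : measurable_fun setT (fun t => g (Zp t, Zm t, M t)).
    exact: measurableT_comp.
  rewrite fineM// fin_num_measure//.
  - exact: (measurable_preimage_int [set b] (mRV _ _ _ Z)).
  - exact: (measurable_preimage_int [set x] mgZ).
have mfst : measurable_fun setT (fun u : int * int * int => u.1.1).
  exact: measurableT_comp.
have msnd : measurable_fun setT (fun u : int * int * int => u.1.2).
  exact: measurableT_comp.
have mthd : measurable_fun setT (fun u : int * int * int => u.2).
  exact: measurable_snd.
have mX : measurable_fun setT
    (fun t => M t + (Z t * Zp t - (1 - Z t) * Zm t)).
  apply: (measurable_comp_int2 +%R mM (measurable_comp_int2 (fun u v => u - v)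
    (measurable_comp_int2 *%R (mRV _ _ _ Z) (mRV _ _ _ Zp))
    (measurable_comp_int2 (fun u v => (1 - u) * v)
      (mRV _ _ _ Z) (mRV _ _ _ Zm)))).
apply: (@pushforward_eq_cond_law _ _ _ P _ _ P M _ [set n | n <> a]) => // x.
rewrite (@prob_split_bool _ _ _ P _ Z)//; first last.
- by rewrite probZ !indicE !memNset/= ?mulr0 ?addr0//; apply: contrapT; tauto.
- exact: (measurable_preimage_int [set x] mX).
have -> : [set t | M t + (Z t * Zp t - (1 - Z t) * Zm t) = x] `&`
    [set t | Z t = 1] = [set t | M t + Zp t = x] `&` [set t | Z t = 1].
  by apply/seteqP; split => t /= [+ Zt]; rewrite Zt => <-; split => //; lia.
have -> : [set t | M t + (Z t * Zp t - (1 - Z t) * Zm t) = x] `&`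
    [set t | Z t = 0] = [set t | M t - Zm t = x] `&` [set t | Z t = 0].
  by apply/seteqP; split => t /= [+ Zt]; rewrite Zt => <-; split => //; lia.
rewrite (indepZ 1 (fun u => u.2 + u.1.1)); last first.
  exact: (measurable_comp_int2 +%R mthd mfst).
rewrite (indepZ 0 (fun u => u.2 - u.1.2)); last first.
  exact: (measurable_comp_int2 (fun u v => u - v) mthd msnd).
have -> : prob P [set t | Z t = 0] = L / W.
  rewrite (probZ [set 0]) !indicE !in_set1/= WE.
  by field; rewrite -WE gt_eqF.
have -> : prob P [set t | Z t = 1] = U / W.
  by rewrite (probZ [set 1]) !indicE !in_set1/= mulr1 mulr0 addr0.
rewrite /= (@prob_add_bernoulli _ _ _ P M Zp (pi_coef P M a))//.
have -> : [set t | M t - Zm t = x] = [set t | - M t + Zm t = - x].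
  by apply/seteqP; split => t /=; lia.
rewrite (@prob_add_bernoulli _ _ _ P _ Zm (pi_coef P (fun t => - M t) (- a)))//;
  first last.
- by apply: cond_bernoulli_opp MZm => n; rewrite rho_coef_opp.
- by move=> n; exact: (pi_coef_itv _ mMN MN_lc).
(* The mixing weights supply exactly the leading tail factors of these identities, so [a + 1] or
   [a - 1] outside the support needs no separate case. *)
have up := tail_pi_coef_shift P mM M_lc a x.
have down := tail_pi_coef_shift P mMN MN_lc (- a) (- x).
rewrite -/U (tailS P mM) -/U in up.
rewrite -/L (tailS P mMN) -/L in down.
rewrite ![_ / W * _]mulrAC up down !preimage_opp_eq !opprK.
rewrite /cond_prob -/W ltrN2 eqr_opp.
have condE : prob P ([set t | M t = x] `&` M @^-1` [set n | n <> a]) =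
    if x == a then 0 else p x.
  case: eqVneq => [->|/eqP xa].
    by rewrite (_ : _ `&` _ = set0) ?prob_set0//; apply/seteqP; split => t //= [].
  by congr prob; apply/seteqP; split => t /= => [[]//|Mx]; rewrite Mx.
rewrite condE -mulrDl; congr (_ / _).
rewrite -/(p x) -/(p a).
(* For [x < a] the numerators are [U * p x] and [p x * (p a + L)], which add up to [p x]; the case
   [x > a] is symmetric, and at [a] both vanish. *)
have -> : L = 1 - p a - U by lra.
by case: ltgtP => _; ring.
Qed.
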